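(* Let $\mathbb A$ be a finite ordered alphabet and let $\mathbf v\in\mathbb N^{\mathbb A}$ be a non-zero vector. If the $\xi$-algorithm (described in the context) succeeds on input $\mathbf v$, then its output $\omega=\omega^{(0)}$ is the unique cyclic singular word over $\mathbb A$ with Parikh vector $\mathbf v$.
   Context: Words: $\mathbb A^+$ (resp. $\mathbb A^*$) is the set of non-empty (resp. all) finite words over $\mathbb A$. For $x=x_1\cdots x_n$ put $x^*=x_n\cdots x_1$. A cyclic word over $\mathbb A$ is an equivalence class of $\mathbb A^+$ under $w\sim w'$ iff $w=pq$, $w'=qp$ for some $p,q\in\mathbb A^*$; ''$\omega=uv$'' means that $uv$ belongs to the class $\omega$. The Parikh vector of $\omega$ is $(|\omega|_d)_{d\in\mathbb A}$, where $|\omega|_d$ is the number of occurrences of $d$. Singular: for words $x\ne y$ of equal length, $x\prec y$ iff $x_i<y_i$ at the first index $i$ where they differ. A cyclic word $\omega$ is singular if for every factorization $\omega=uv$ with $u,v\in\mathbb A^+$, $u\neq u^*$, $v\neq v^*$ one has ($u\prec u^*\iff v\prec v^*$). $\delta$: for $\mathbf v=(n_d)_{d\in\mathbb A}$ and $b\in\mathbb A$, $\delta_b(\mathbf v)=\sum_{c>b}n_c-\sum_{a<b}n_a$. $\mathbf e_b$ is the unit vector indexed by $b$. The map $\xi_b$ on cyclic words: for a cyclic word $\omega$ that is not a power of $b$, $\xi_b(\omega)$ is the cyclic word obtained from $\omega$ by adding one occurrence of $b$ to each (cyclic) maximal run of consecutive $b$'s, and inserting one $b$ between any two cyclically consecutive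 letters $d,d'$ with $b<\min\{d,d'\}$ or $b>\max\{d,d'\}$ (in a one-letter cyclic word the letter is considered to be followed by itself). The $\xi$-algorithm on input $\mathbf v=\mathbf v^{(0)}$: (1) given $\mathbf v^{(i)}=(n_d)_{d\in\mathbb A}$, let $b_i$ be the least $b\in\mathbb A$ such that $n_b\ge|\delta_b(\mathbf v^{(i)})|$; (2) if $\delta_{b_i}(\mathbf v^{(i)})\neq0$, set $\mathbf v^{(i+1)}=\mathbf v^{(i)}-|\delta_{b_i}(\mathbf v^{(i)})|\,\mathbf e_{b_i}$ and restart from $\mathbf v^{(i+1)}$; (3) repeat until reaching $\mathbf v^{(m)}$ with $\delta_{b_m}(\mathbf v^{(m)})=0$; (4) if $\mathbf v^{(m)}$ is not a multiple of $\mathbf e_{b_m}$, the algorithm fails; otherwise it succeeds, and $\omega^{(m)}=b_m^k$ is the only cyclic word with Parikh vector $\mathbf v^{(m)}=k\,\mathbf e_{b_m}$; (5) for $i=m-1,\ldots,0$ set $\omega^{(i)}=\xi_{b_i}(\omega^{(i+1)})$. The output is $\omega^{(0)}$. *)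

(* Defs.v *)
From HB Require Import structures.
From mathcomp Require Import all_boot all_order all_algebra.

Set Implicit Arguments.
Unset Strict Implicit.
Unset Printing Implicit Defensive.

Import Order.TTheory GRing.Theory Num.Theory.

Local Open Scope quotient_scope.

Lemma zip_rot (S T : Type) i (s : seq S) (t : seq T) :
  size s = size t -> zip (rot i s) (rot i t) = rot i (zip s t).
Proof.
move=> eq_st; rewrite /rot zip_cat ?size_drop ?eq_st //.
congr (_ ++ _); first by elim: i s t eq_st => [|i IHi] [|x s] [|y t] //= [/IHi].
by elim: i s t eq_st => [|i IHi] [|x s] [|y t] //= [/IHi->].
Qed.

Section Conjugacy.
Context {disp : Order.disp_t} (A : finOrderType disp).

Definition nonempty_word := {w : seq A | w != [::]}.

Definition conjugate (w w' : seq A) : bool :=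
  [exists i : 'I_(size w).+1, w' == rot i w].

Lemma conjugate_rot w n : conjugate w (rot n w).
Proof.
rewrite rot_minn; apply/existsP.
have lt_n : minn n (size w) < (size w).+1 by rewrite ltnS geq_minr.
by exists (Ordinal lt_n).
Qed.

Lemma conjugateP w w' :
  reflect (exists p q, w = p ++ q /\ w' = q ++ p) (conjugate w w').
Proof.
apply: (iffP existsP) => [[i /eqP->]|[p [q [-> ->]]]].
  by exists (take i w), (drop i w); rewrite cat_take_drop.
by have := conjugate_rot (p ++ q) (size p); rewrite rot_size_cat => /existsP.
Qed.

Lemma conjugate_sym_imp w w' : conjugate w w' -> conjugate w' w.
Proof. by case/conjugateP=> p [q [-> ->]]; apply/conjugateP; exists q, p. Qed.

Definition nonempty_conjugate (w w' : nonempty_word) : bool :=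
  conjugate (val w) (val w').

Lemma nonempty_conjugate_refl : reflexive nonempty_conjugate.
Proof. by move=> w; rewrite /nonempty_conjugate -{2}(rot0 (val w)) conjugate_rot. Qed.

Lemma nonempty_conjugate_sym : symmetric nonempty_conjugate.
Proof. by move=> w w'; apply/idP/idP; apply: conjugate_sym_imp. Qed.

Lemma nonempty_conjugate_trans : transitive nonempty_conjugate.
Proof.
rewrite /nonempty_conjugate => w2 w1 w3.
by case/existsP=> i /eqP-> /existsP[j /eqP->]; rewrite rot_rot_add conjugate_rot.
Qed.

Canonical conjugacy := EquivRel nonempty_conjugate
  nonempty_conjugate_refl nonempty_conjugate_sym nonempty_conjugate_trans.

Definition cyclic_word := {eq_quot conjugacy}.

End Conjugacy.

Section CyclicWords.
Context {disp : Order.disp_t} {A : finOrderType disp}.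
Implicit Types (w u v : seq A) (omega : cyclic_word A) (b d : A).

Definition cyclic_of w (w_neq0 : w != [::]) : cyclic_word A :=
  \pi_(cyclic_word A) (exist _ w w_neq0 : nonempty_word A).

Definition linearize omega : seq A := val (repr omega).

Lemma linearize_neq0 omega : linearize omega != [::].
Proof. exact: valP (repr omega). Qed.

(* The word w belongs to the class omega; "omega = uv" is [spells omega (u ++ v)]. *)
Definition spells omega w : Prop :=
  exists w_neq0 : w != [::], cyclic_of w_neq0 = omega.

Lemma cyclic_of_eq w w' (w0 : w != [::]) (w'0 : w' != [::]) :
  cyclic_of w0 = cyclic_of w'0 <-> conjugate w w'.
Proof.
by split=> [/eqP|ww']; [rewrite eqmodE|apply/eqP; rewrite eqmodE].
Qed.

Lemma linearizeK omega : cyclic_of (linearize_neq0 omega) = omega.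
Proof.
rewrite -[RHS]reprK /cyclic_of; congr (\pi_(cyclic_word A) _).
exact: val_inj.
Qed.

Lemma conjugate_linearize w (w0 : w != [::]) :
  conjugate w (linearize (cyclic_of w0)).
Proof. by apply/(cyclic_of_eq w0 (linearize_neq0 _)); rewrite linearizeK. Qed.

Definition parikh omega : {ffun A -> nat} :=
  [ffun d => count_mem d (linearize omega)].

Lemma parikh_cyclic_of w (w0 : w != [::]) :
  parikh (cyclic_of w0) = [ffun d => count_mem d w].
Proof.
apply/ffunP => d; rewrite !ffunE.
have /existsP[i /eqP->] := conjugate_linearize w0.
by apply/permP; rewrite perm_rot.
Qed.

(* On words of equal length, the lexicographic order of the library compares
   the first letters that differ. *)
Definition lex_lt u v : bool := ((u : seqlexi A) < (v : seqlexi A))%O.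

Definition singular omega : Prop :=
  forall u v : seq A, u != [::] -> v != [::] -> spells omega (u ++ v) ->
    u <> rev u -> v <> rev v ->
    (lex_lt u (rev u) <-> lex_lt v (rev v)).

(* Whether xi_b puts a b between the cyclically consecutive letters d and d'.
   The first case is the end of a maximal run of b's, where the occurrence of b
   added to that run is placed. *)
Definition xi_inserts b d d' : bool :=
  [|| (d == b) && (d' != b), (b < Order.min d d')%O | (Order.max d d' < b)%O].

(* [rot 1 w] lists the cyclic successors of the letters of w. *)
Definition xi_word b w : seq A :=
  flatten [seq p.1 :: nseq (xi_inserts b p.1 p.2) b | p <- zip w (rot 1 w)].

Lemma xi_word_neq0 b w : w != [::] -> xi_word b w != [::].
Proof. by case: w => [|x [|y w]]. Qed.

(* On the powers of b, which are not in the domain of xi_b, this is the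
   identity. *)
Definition xi b omega : cyclic_word A :=
  cyclic_of (xi_word_neq0 b (linearize_neq0 omega)).

Lemma xi_word_conjugate b w w' :
  conjugate w w' -> conjugate (xi_word b w) (xi_word b w').
Proof.
case/existsP=> i /eqP->; rewrite /xi_word rot_rot zip_rot ?size_rot // map_rot.
rewrite /rot flatten_cat; apply/conjugateP.
by eexists _, _; split; last reflexivity; rewrite -flatten_cat cat_take_drop.
Qed.

Lemma xi_cyclic_of b w (w0 : w != [::]) :
  xi b (cyclic_of w0) = cyclic_of (xi_word_neq0 b w0).
Proof.
by apply/esym/cyclic_of_eq/xi_word_conjugate/conjugate_linearize.
Qed.

Definition power b k : cyclic_word A :=
  @cyclic_of (nseq k.+1 b) isT.

Definition delta (n : {ffun A -> nat}) b : int :=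
  (\sum_(c | (b < c)%O) (n c)%:Z - \sum_(a | (a < b)%O) (n a)%:Z)%R.

Definition scaled_unit k b : {ffun A -> nat} :=
  [ffun d => if d == b then k else 0].

Definition selected (n : {ffun A -> nat}) b : Prop :=
  `|delta n b|%N <= n b /\
  forall c, `|delta n c|%N <= n c -> (b <= c)%O.

(* The subtraction in nat is not truncated when [selected n b]. *)
Definition xi_reduce (n : {ffun A -> nat}) b : {ffun A -> nat} :=
  [ffun d => n d - scaled_unit `|delta n b|%N b d].

(* [xi_algorithm n omega]: the xi-algorithm succeeds on input n with output
   omega.  There is no rule for a vector n with [delta n b = 0] at the selected
   letter b that is not a multiple of the unit vector at b: there the algorithm
   fails.  Powers b^k have k > 0 since cyclic words are non-empty; [power b k]
   is b^(k+1). *)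
Inductive xi_algorithm : {ffun A -> nat} -> cyclic_word A -> Prop :=
| Xi_stop n b k of
    selected n b & delta n b = 0%R & n = scaled_unit k.+1 b :
    xi_algorithm n (power b k)
| Xi_step n b omega of
    selected n b & delta n b <> 0%R & xi_algorithm (xi_reduce n b) omega :
    xi_algorithm n (xi b omega).

End CyclicWords.

(* Main.v *)
(* Reading a periodic bi-infinite word leftwards and rightwards from a cut point
   gives a pair (l, r) of infinite words, and a cyclic word is singular iff no
   two of its cuts satisfy r < l' and l < r'.  Fix b with delta_b <> 0, say
   delta_b < 0, and call a letter low if it is < b and high if it is > b (for
   delta_b > 0 the order is reversed, which preserves the condition on cuts).
   Since low letters outnumber high ones, one-letter comparisons show that a
   singular word has no two adjacent high letters and no b next to a high one.
   On such words xi_b acts on l and r by strictly increasing maps, so it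
   preserves and reflects singularity, and it adds exactly |delta_b| letters b.
   If moreover n_b >= |delta_b|, then no two low letters are adjacent either and
   the word lies in the image of xi_b.  The theorem follows by induction on the
   run of the algorithm. *)
Require Import Defs.
From mathcomp Require Import all_boot all_order all_algebra.
From Stdlib Require Import Classical FunctionalExtensionality.
From mathcomp Require Import zify.

Set Implicit Arguments.
Unset Strict Implicit.
Unset Printing Implicit Defensive.

Import Order.TTheory GRing.Theory Num.Theory.

(** * Infinite words and their periods *)

Section Streams.
Context {T : Type}.
Implicit Types (s t : nat -> T) (u v : seq T).

Definition scons (x : T) s : nat -> T := fun n => if n is m.+1 then s m else x.

Definition stail s : nat -> T := fun n => s n.+1.

Definition sapp u s : nat -> T := foldr scons s u.

Lemma scons_eta s : s = scons (s 0) (stail s).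
Proof. by apply: functional_extensionality; case. Qed.

Lemma scons_inj x y s t : scons x s = scons y t -> x = y /\ s = t.
Proof.
move=> e; split; first exact: (congr1 (fun f => f 0) e).
by apply: functional_extensionality => n; apply: (congr1 (fun f => f n.+1) e).
Qed.

Lemma sapp_cat u v s : sapp (u ++ v) s = sapp u (sapp v s).
Proof. exact: foldr_cat. Qed.

Lemma sapp_nth x0 u s n :
  sapp u s n = if n < size u then nth x0 u n else s (n - size u).
Proof. by elim: u n => [|x u IHu] [|n] //=; rewrite IHu. Qed.

Lemma periodic_exists u : u <> [::] -> exists s, s = sapp u s.
Proof.
case: u => // x u _; exists (fun n => nth x (x :: u) (n %% size (x :: u))).
apply: functional_extensionality => n; rewrite (sapp_nth x).
case: ltnP => [lt_n|le_n]; first by rewrite modn_small.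
by rewrite -{1}(subnK le_n) modnDr.
Qed.

Lemma periodic_unique u s t :
  u <> [::] -> s = sapp u s -> t = sapp u t -> s = t.
Proof.
case: u => // x u _ es et; apply: functional_extensionality => n.
have [m] := ubnP n; elim: m n => // m IHm n /ltnSE le_nm.
rewrite es et !(sapp_nth x); case: ltnP => // le_un; apply: IHm.
by move: le_un le_nm => /=; lia.
Qed.

End Streams.

(** * Cuts of a periodic bi-infinite word *)

Section Conjugates.
Context {disp : Order.disp_t} {A : finOrderType disp}.
Implicit Types (w x y s t : seq A) (l r : nat -> A).

Lemma conjugate_refl w : conjugate w w.
Proof. by have := conjugate_rot w 0; rewrite rot0. Qed.

Lemma conjugate_trans w x y : conjugate w x -> conjugate x y -> conjugate w y.
Proof.
by case/existsP=> i /eqP-> /existsP[j /eqP->]; rewrite rot_rot_add conjugate_rot.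
Qed.

Lemma conjugate_neq0 w x : conjugate w x -> w <> [::] -> x <> [::].
Proof. by case/existsP=> i /eqP-> w0 /(congr1 size); rewrite size_rot => /size0nil. Qed.

Lemma conjugate_count w x p : conjugate w x -> count p x = count p w.
Proof. by case/existsP=> i /eqP->; apply/permP; rewrite perm_rot. Qed.

(* The infinite words l and r are what one reads leftwards and rightwards from
   a cut point of the periodic bi-infinite word with period w. *)
Definition cut w l r : Prop :=
  exists x, [/\ conjugate w x, l = sapp (rev x) l & r = sapp x r].

Lemma cut_conjugate w w' l r : conjugate w w' -> cut w' l r -> cut w l r.
Proof. by move=> ww' [x [cx el er]]; exists x; split=> //; apply: conjugate_trans cx. Qed.

Lemma cut_exists w : w <> [::] ->
  exists l r, [/\ l = sapp (rev w) l, r = sapp w r & cut w l r].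
Proof.
move=> w0; have [r er] := periodic_exists w0.
have [l el] : exists l, l = sapp (rev w) l.
  by apply: periodic_exists => /(congr1 size); rewrite size_rev => /size0nil.
by exists l, r; split=> //; exists w; split=> //; apply: conjugate_refl.
Qed.

Lemma cut_shiftr w l a r : w <> [::] -> cut w l (scons a r) -> cut w (scons a l) r.
Proof.
move=> w0 [x [cx el er]]; have := conjugate_neq0 cx w0.
case: x cx el er => // y x cx el er0 _; have [ey er] := scons_inj er0; subst y.
exists (rcons x a); split.
- by apply: conjugate_trans cx _; rewrite -rot1_cons conjugate_rot.
- rewrite rev_rcons /=; congr scons.
  by rewrite {1}el rev_cons -cats1 sapp_cat.
- by rewrite -cats1 sapp_cat.
Qed.

Lemma cut_shiftl w l a r : w <> [::] -> cut w (scons a l) r -> cut w l (scons a r).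
Proof.
move=> w0 [x [cx el er]]; have := conjugate_neq0 cx w0.
case: (lastP x) cx el er => // {}x y cx el er _.
have [ey el0] := scons_inj (etrans el (congr1 (sapp^~ _) (rev_rcons x y))); subst y.
exists (a :: x); split.
- by apply: conjugate_trans cx _; apply: conjugate_sym_imp; rewrite -rot1_cons conjugate_rot.
- by rewrite rev_cons -cats1 sapp_cat.
- by rewrite /= {1}er -cats1 sapp_cat.
Qed.

(** Any cut is reached from a given one by finitely many shifts to the right: if the two periods are
    [p ++ q] and [q ++ p], by crossing [p]. *)
Lemma cut_orbit w (T : (nat -> A) -> (nat -> A) -> Prop) l0 r0 : w <> [::] ->
    (forall l a r, T l (scons a r) -> T (scons a l) r) ->
    cut w l0 r0 -> T l0 r0 -> forall l r, cut w l r -> T l r.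
Proof.
move=> w0 shT [x0 [cx0 el0 er0]] T0 l r [x [cx el er]].
have shTs p l1 r1 : T l1 (sapp p r1) -> T (sapp (rev p) l1) r1.
  elim: p l1 => //= a p IHp l1 /shT/IHp.
  by rewrite rev_cons -cats1 sapp_cat.
have /conjugateP[p [q [ex0 ex]]] : conjugate x0 x.
  exact: conjugate_trans (conjugate_sym_imp cx0) cx.
have x_neq0 := conjugate_neq0 cx w0.
have -> : l = sapp (rev p) l0.
  apply: (periodic_unique _ el).
    by move=> /(congr1 size); rewrite size_rev => /size0nil.
  by rewrite ex rev_cat sapp_cat -(sapp_cat (rev q)) -rev_cat -ex0 -el0.
have -> : r = sapp q r0.
  by apply: (periodic_unique x_neq0 er); rewrite ex sapp_cat -(sapp_cat p) -ex0 -er0.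
by apply: shTs; rewrite -sapp_cat -ex0 -er0.
Qed.

Lemma cut_ends w l r : w <> [::] -> cut w l r ->
  exists c s, [/\ conjugate w (c :: s), r 0 = c & l 0 = last c s].
Proof.
move=> w0 [x [cx el er]]; have := conjugate_neq0 cx w0.
case: x cx el er => // c s cx el er _; exists c, s; split=> //; first by rewrite er.
by rewrite el; case: (lastP s) => //= s' y; rewrite last_rcons -rcons_cons rev_rcons.
Qed.

(** The pairs [(l 0, r 0)] over all cuts are the cyclically adjacent pairs of [w], so local
    conditions on letters can be read at cuts. *)
Lemma cycle_cutP (e : rel A) w : w <> [::] ->
  (forall l r, cut w l r -> e (l 0) (r 0)) <-> cycle e w.
Proof.
case: w => // c s _; split=> [ecut|ce l r cut_lr].
  have e_seam d t : conjugate (c :: s) (d :: t) -> e (last d t) d.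
    move=> cdt; have [//|l [r [el er cut_lr]]] := @cut_exists (d :: t).
    have := ecut _ _ (cut_conjugate cdt cut_lr).
    by rewrite el er; case: (lastP t) => //= t' y; rewrite last_rcons -rcons_cons rev_rcons.
  rewrite /= rcons_path e_seam ?conjugate_refl // andbT.
  suff prefixP: forall s1 s2, s = s1 ++ s2 -> path e c s1.
    by apply: (prefixP s [::]); rewrite cats0.
  elim/last_ind=> // s1 y IHs s2 es; rewrite rcons_path (IHs (y :: s2)) ?es ?cat_rcons //=.
  (* In the rotation starting at [y], the step into [y] is the seam. *)
  have := e_seam y (s2 ++ c :: s1); rewrite last_cat /=; apply.
  by apply/conjugateP; exists (c :: s1), (y :: s2); rewrite es cat_rcons.
have [//|d [t [cdt -> ->]]] := cut_ends _ cut_lr.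
have : cycle e (d :: t) by case/existsP: cdt => i /eqP->; rewrite rot_cycle.
by rewrite /= rcons_path => /andP[_].
Qed.

End Conjugates.

(** * Lexicographic order on infinite words *)

Section OrderCondition.
Context {disp : Order.disp_t} {A : finOrderType disp}.
Variable dual : bool.
Implicit Types (x y a : A) (u v w : seq A) (l r s t : nat -> A).

(* Reversing the order reduces delta_b > 0 to delta_b < 0. *)
Definition before x y : bool := if dual then (y < x)%O else (x < y)%O.

Lemma beforexx x : before x x = false.
Proof. by rewrite /before; case: dual; rewrite ltxx. Qed.

Lemma before_trans : transitive before.
Proof.
by move=> y x z; rewrite /before; case: dual => h k; [apply: lt_trans k h|apply: lt_trans h k].
Qed.

Lemma before_asym x y : before x y -> before y x = false.
Proof. by move=> xy; apply/negP => /(before_trans xy); rewrite beforexx. Qed.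

Variant compare_before x y : bool -> bool -> bool -> Type :=
| CompareBefore of before x y : compare_before x y true false false
| CompareAfter of before y x : compare_before x y false true false
| CompareEq of x = y : compare_before x y false false true.

Lemma beforeP x y : compare_before x y (before x y) (before y x) (x == y).
Proof.
have [->|neq_xy] := eqVneq x y; first by rewrite beforexx; constructor.
have : before x y || before y x.
  by rewrite /before; case: dual; move: neq_xy; case: ltgtP.
case xy: (before x y) => /=; first by rewrite before_asym //; constructor.
by move=> yx; rewrite yx; constructor.
Qed.

(** A derivation consists of a common prefix and a first difference, so induction on it is induction
    on the length of that prefix. *)
Inductive slt : (nat -> A) -> (nat -> A) -> Prop :=
| Slt_head x y s t of before x y : slt (scons x s) (scons y t)
| Slt_tail x s t of slt s t : slt (scons x s) (scons x t).

Lemma slt_cons x y s t :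
  slt (scons x s) (scons y t) <-> before x y \/ x = y /\ slt s t.
Proof.
split=> [lt_st|[xy|[-> st]]]; [|exact: Slt_head|exact: Slt_tail].
remember (scons x s) as s' eqn:es; remember (scons y t) as t' eqn:et.
case: lt_st es et => [x' y' s1 t1 xy|x' s1 t1 st] es et.
  by have [<- _] := scons_inj es; have [<- _] := scons_inj et; left.
by have [<- <-] := scons_inj es; have [<- <-] := scons_inj et; right.
Qed.

Lemma slt_irr s : ~ slt s s.
Proof.
suff neq t : slt s t -> s <> t by move=> /neq.
elim=> [x y s1 t1 xy|x s1 t1 _ IH] e; have [exy est] := scons_inj e => //.
by rewrite exy beforexx in xy.
Qed.

Lemma slt_asym s t : slt s t -> ~ slt t s.
Proof.
elim=> [x y s1 t1 xy|x s1 t1 _ IH] /slt_cons[yx|[exy ts]].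
- by rewrite before_asym in yx.
- by rewrite exy beforexx in xy.
- by rewrite beforexx in yx.
- exact: IH.
Qed.

Lemma slt_total s t : s <> t -> slt s t \/ slt t s.
Proof.
move=> neq_st; have [n] : exists n, s n <> t n.
  by apply: not_all_ex_not => eq_st; apply/neq_st/functional_extensionality.
elim: n s t {neq_st} => [|n IHn] s t; rewrite (scons_eta s) (scons_eta t) => /= neq_n.
all: case: (beforeP (s 0) (t 0)) => [st|ts|est];
  [by left; apply: Slt_head|by right; apply: Slt_head|].
  by [].
by rewrite est; case: (IHn _ _ neq_n) => ?; [left|right]; apply: Slt_tail.
Qed.

Lemma slt_head s t : slt s t -> before (t 0) (s 0) = false.
Proof. by case=> /= [x y ? ? /before_asym|x ? ? _] //; rewrite beforexx. Qed.

Definition order_condition w : Prop := forall l r l' r',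
  cut w l r -> cut w l' r' -> slt r l' -> ~ slt l r'.

Lemma order_condition_conjugate w w' :
  conjugate w w' -> order_condition w -> order_condition w'.
Proof. by move=> ww' ow l r l' r' /(cut_conjugate ww') c /(cut_conjugate ww') /(ow _ _ _ _ c). Qed.

Lemma order_condition_head w l r l' r' :
    order_condition w -> cut w l r -> cut w l' r' ->
  before (r 0) (l' 0) -> before (l 0) (r' 0) = false.
Proof.
move=> ow c c' lt_r; apply/negP => lt_l; apply: (ow _ _ _ _ c c').
  by rewrite (scons_eta r) (scons_eta l'); apply: Slt_head.
by rewrite (scons_eta l) (scons_eta r'); apply: Slt_head.
Qed.

End OrderCondition.

(** * Singularity as a condition on pairs of cuts *)

Section Singular.
Context {disp : Order.disp_t} {A : finOrderType disp}.
Implicit Types (x y a : A) (u v w : seq A) (l r s t : nat -> A).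

Lemma slt_negb dual s t : slt dual s t -> slt (~~ dual) t s.
Proof.
elim=> [x y s1 t1 xy|x s1 t1 _ IH]; [apply: Slt_head|exact: Slt_tail].
by move: xy; rewrite /before; case: dual.
Qed.

(** Reversing the order turns the two inequalities for a pair of cuts into those for the exchanged
    pair. *)
Lemma order_condition_dual dual w :
  order_condition false w <-> order_condition dual w.
Proof.
have negb_imp d : order_condition d w -> order_condition (~~ d) w.
  move=> ow l r l' r' c c' /slt_negb lt1 /slt_negb lt2.
  by move: lt1 lt2; rewrite negbK => lt1 lt2; apply: (ow _ _ _ _ c' c lt2 lt1).
by case: dual => //; split; apply: negb_imp.
Qed.

Lemma slt_sapp u v s t : size u = size v ->
  slt false (sapp u s) (sapp v t) <-> lex_lt u v \/ u = v /\ slt false s t.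
Proof.
elim: u v => [|x u IHu] [|y v] //=.
  by move=> _; rewrite /lex_lt ltxx; split=> [|[//|[]//]]; right.
move=> [/IHu IH]; rewrite slt_cons IH /lex_lt ltxi_cons /before.
case: ltgtP => /= [xy|xy|->]; split.
- by left.
- by left.
- by case=> // -[exy]; rewrite exy ltxx in xy.
- by case=> // -[[exy]]; rewrite exy ltxx in xy.
- by case=> // -[_ [?|[-> ?]]]; auto.
- by case=> [?|[[->] ?]]; right; auto.
Qed.

Lemma lex_lt_total u v : u <> v -> lex_lt u v \/ lex_lt v u.
Proof. by move=> neq_uv; rewrite /lex_lt; case: (ltgtP (u : seqlexi A) v); auto. Qed.

Lemma lex_ltxx u : lex_lt u u = false.
Proof. exact: ltxx. Qed.

Lemma lex_lt_asym u v : lex_lt u v -> lex_lt v u = false.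
Proof. by rewrite /lex_lt => uv; case: ltgtP uv. Qed.

(** For cuts with periods [u ++ v] and [v ++ u], comparing [r] with [l'] compares [u] with [rev u],
    then [v] with [rev v]; comparing [l] with [r'] compares [rev v] with [v], then [rev u] with
    [u]. *)
Lemma singularP w (w0 : w != [::]) :
  singular (cyclic_of w0) <-> order_condition false w.
Proof.
have w_neq0 : w <> [::] by apply/eqP.
split=> [sing l r l' r' [x [cx el er]] [y [cy el' er']] lt1 lt2|ow u v u0 v0 suv nu nv].
  have /conjugateP[u [v [ex ey]]] := conjugate_trans (conjugate_sym_imp cx) cy.
  have x_neq0 := conjugate_neq0 cx w_neq0.
  move: lt1; rewrite er el' {1}ex {1}ey rev_cat !sapp_cat.
  move=> /slt_sapp; rewrite size_rev => /(_ erefl) lt1.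
  move: lt2; rewrite el er' {1}ex {1}ey rev_cat !sapp_cat.
  move=> /slt_sapp; rewrite size_rev => /(_ erefl) lt2.
  case: lt1 lt2 => [ltu|[eu /slt_sapp]]; last rewrite size_rev => /(_ erefl) lt1.
    (* If [v] is a palindrome, the second comparison goes on to [rev u] against [u], contrary to
       [ltu]. *)
    case=> [ltv|[_ /slt_sapp]]; last first.
      by rewrite size_rev => /(_ erefl)[|[eu _]]; [rewrite lex_lt_asym|rewrite eu lex_ltxx in ltu].
    have nu : u <> rev u by move=> eu; rewrite -eu lex_ltxx in ltu.
    have nv : v <> rev v by move=> ev; rewrite -ev lex_ltxx in ltv.
    have u0 : u != [::] by apply/eqP => eu; rewrite eu in nu.
    have v0 : v != [::] by apply/eqP => ev; rewrite ev in nv.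
    have suv : spells (cyclic_of w0) (u ++ v).
      have uv0 : u ++ v != [::] by rewrite -ex; apply/eqP.
      by exists uv0; apply/cyclic_of_eq; rewrite -ex; apply: conjugate_sym_imp.
    by have /(sing u v u0 v0 suv nu nv) := ltu; rewrite lex_lt_asym.
  case: lt1 => [ltv|[ev lt1]].
    case=> [|[ev _]]; first by rewrite lex_lt_asym.
    by rewrite ev lex_ltxx in ltv.
  (* Both factors are palindromes, so [l'] and [r] have the same period. *)
  have elr : l' = r.
    apply: (periodic_unique x_neq0 _ er).
    by rewrite {1}el' ey rev_cat -eu -ev -ex.
  by move=> _; move: lt1; rewrite elr => /slt_irr.
case: suv => uv0 /cyclic_of_eq cuv.
have uv_neq0 : u ++ v <> [::] by apply/eqP.
have vu_neq0 : v ++ u <> [::] by case: (v) v0.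
have [l [r [el er cut1]]] := cut_exists uv_neq0.
have [l' [r' [el' er' cut2]]] := cut_exists vu_neq0.
have cvu : conjugate (u ++ v) (v ++ u) by apply/conjugateP; exists u, v.
have cw := conjugate_sym_imp cuv.
have {}cut1 := cut_conjugate cw cut1.
have {}cut2 := cut_conjugate cw (cut_conjugate cvu cut2).
rewrite rev_cat in el; rewrite rev_cat in el'.
split=> lt_uv.
  case: (lex_lt_total nv) => // lt_v; case: (ow _ _ _ _ cut1 cut2).
    by rewrite er el' !sapp_cat; apply/slt_sapp; rewrite ?size_rev //; left.
  by rewrite el er' !sapp_cat; apply/slt_sapp; rewrite ?size_rev //; left.
case: (lex_lt_total nu) => // lt_u; case: (ow _ _ _ _ cut2 cut1).
  by rewrite er' el !sapp_cat; apply/slt_sapp; rewrite ?size_rev //; left.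
by rewrite el' er !sapp_cat; apply/slt_sapp; rewrite ?size_rev //; left.
Qed.

End Singular.

(** * The map [xi b] as a substitution on infinite words *)

Section Substitution.
Context {disp : Order.disp_t} {A : finOrderType disp}.
Variables (dual : bool) (b : A).
Implicit Types (c d x y a : A) (u v w : seq A) (l r s t : nat -> A).

Definition low x : bool := before dual x b.
Definition high x : bool := before dual b x.

Lemma lowP x : compare_before dual x b (low x) (high x) (x == b).
Proof. exact: beforeP. Qed.

Lemma low_b : low b = false. Proof. exact: beforexx. Qed.
Lemma high_b : high b = false. Proof. exact: beforexx. Qed.

Lemma low_nhigh x : low x -> high x = false.
Proof. by case: lowP. Qed.

Lemma high_nlow x : high x -> low x = false.
Proof. by case: lowP. Qed.

Definition separated x y : bool := (high x ==> low y) && (high y ==> low x).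

Lemma separated_bl y : separated b y -> high y = false.
Proof. by rewrite /separated low_b implybF => /andP[_ /negPf]. Qed.

Lemma separated_br x : separated x b -> high x = false.
Proof. by rewrite /separated low_b implybF => /andP[/negPf]. Qed.

Lemma separated_highr x y : separated x y -> high y -> low x.
Proof. by case/andP=> _ /implyP. Qed.

Lemma separated_highl x y : separated x y -> high x -> low y.
Proof. by case/andP=> /implyP. Qed.

(** Recursion on the position: a low letter and the [b] inserted after it take up two positions at
    once. *)
Fixpoint phi_nth (n : nat) s : A :=
  if n is m.+1 then
    if low (s 0) && ~~ high (s 1) then
      (if m is k.+1 then phi_nth k (stail s) else b)
    else phi_nth m (stail s)
  else s 0.

(* phi inserts a b after every low letter that is not followed by a high one.
   In the free group it is the morphism fixing b with x |-> x b for x low and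
   x |-> b^-1 x for x high, and psi is b phi; phi itself is only meaningful on
   words that do not begin with a high letter. *)
Definition phi s : nat -> A := phi_nth^~ s.

Definition psi s : nat -> A := if high (s 0) then phi s else scons b (phi s).

Lemma phi_head s : phi s 0 = s 0.
Proof. by []. Qed.

Lemma phi_scons x s : phi (scons x s) = scons x (if low x then psi s else phi s).
Proof.
apply: functional_extensionality; case=> // n.
rewrite /phi /psi /=; case: (low x) => //=.
by case: (high (s 0)) => //=; case: n.
Qed.

Lemma psi_high x s : high x -> psi (scons x s) = phi (scons x s).
Proof. by rewrite /psi /= => ->. Qed.

Lemma psi_cons x s : high x = false -> psi (scons x s) = scons b (phi (scons x s)).
Proof. by rewrite /psi /= => ->. Qed.

Lemma psi_nhigh s : high (s 0) = false -> psi s = scons b (phi s).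
Proof. by rewrite /psi => ->. Qed.

Lemma phi_low x s : low x -> phi (scons x s) = scons x (psi s).
Proof. by rewrite phi_scons => ->. Qed.

Lemma phi_nlow x s : low x = false -> phi (scons x s) = scons x (phi s).
Proof. by rewrite phi_scons => ->. Qed.

(** A word to which [psi] adds [b] in front precedes one that starts with a high letter; the
    opposite case contradicts the order of the first letters of [s] and [t]. *)
Lemma psi_slt_aux s t :
  slt dual s t -> slt dual (phi s) (phi t) -> slt dual (psi s) (psi t).
Proof.
move=> /slt_head lt0 lt_phi; rewrite /psi.
case hs: (high (s 0)); case ht: (high (t 0)) => //.
- by move: hs ht lt0; rewrite /high; case: (beforeP dual (t 0) (s 0)) => // [st|->] bs;
    rewrite ?(before_trans bs st) // bs.
- by rewrite (scons_eta (phi t)); apply: Slt_head.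
- exact: Slt_tail.
Qed.

Lemma phi_slt s t : slt dual s t -> slt dual (phi s) (phi t).
Proof.
elim=> [x y s1 t1 xy|x s1 t1 lt1 IH]; rewrite !phi_scons; first exact: Slt_head.
by apply: Slt_tail; case: (low x) => //; apply: psi_slt_aux.
Qed.

Lemma psi_slt s t : slt dual s t -> slt dual (psi s) (psi t).
Proof. by move=> lt_st; apply/psi_slt_aux/phi_slt. Qed.

Lemma slt_reflect (f : (nat -> A) -> (nat -> A)) :
    (forall s t, slt dual s t -> slt dual (f s) (f t)) ->
  forall s t, slt dual (f s) (f t) -> slt dual s t.
Proof.
move=> mono s t lt_f; have neq_st : s <> t by move=> e; move: lt_f; rewrite e => /slt_irr.
by case: (slt_total dual neq_st) => // /mono /slt_asym.
Qed.

Definition inserts x y : bool := low x && ~~ high y.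

(* y is the letter following u. *)
Fixpoint insert_b (i : rel A) u y : seq A :=
  if u is x :: u' then x :: nseq (i x (head y u')) b ++ insert_b i u' y else [::].

Lemma insert_b_rcons i u x y :
  insert_b i (rcons u x) y = insert_b i u x ++ x :: nseq (i x y) b.
Proof.
elim: u => [|z u IHu] /=; first by rewrite cats0.
by rewrite IHu -catA; case: u {IHu}.
Qed.

Lemma phi_sapp u s : phi (sapp u s) =
  sapp (insert_b inserts u (s 0)) (phi s).
Proof.
elim: u => // x u IHu /=; rewrite phi_scons sapp_cat -IHu; congr scons.
have e0 : sapp u s 0 = head (s 0) u by case: (u).
rewrite /inserts /psi e0; case: (low x) => //=.
by case: (high _).
Qed.

(* The leftward reading of the same insertion, started in the middle of the
   possibly inserted b. *)
Lemma psi_sapp_rev u y s :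
    path separated (s 0) (rcons u y) -> high (head y u) = false ->
  (if high y then phi else psi) (sapp (rev u) s) =
  sapp (rev (insert_b inserts u y)) (psi s).
Proof.
elim/last_ind: u y => [|u x IHu] y /=; first by move=> _ ->.
rewrite rcons_path last_rcons => /andP[pu sep_xy] hd_u.
rewrite rev_rcons /= insert_b_rcons rev_cat rev_cons sapp_cat -cats1 sapp_cat /=.
have hd_x : high (head x u) = false by case: (u) hd_u.
have {IHu} := IHu x pu hd_x.
case hy: (high y).
  have lx := separated_highr sep_xy hy.
  by rewrite (low_nhigh lx) phi_low // /inserts lx hy /= => ->.
have [lx|hx|ex] := lowP x.
- by rewrite psi_cons ?low_nhigh // phi_low // /inserts /low lx hy /= => ->.
- by rewrite psi_high // phi_nlow ?high_nlow // /inserts high_nlow //= => ->.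
- rewrite ex => eq_psi; rewrite psi_cons ?high_b // phi_nlow ?low_b //.
  rewrite /inserts low_b /=; congr scons; rewrite -eq_psi psi_nhigh //.
  (* The letter to the left of this [b] is not high, so [psi] puts a [b] before what remains. *)
  case: (lastP u) pu {eq_psi hd_u hd_x} => [|u' z] /=; rewrite ex.
    by rewrite andbT => /separated_br.
  by rewrite rev_rcons rcons_path last_rcons => /andP[_ /separated_br].
Qed.


Lemma xi_insertsE x y : xi_inserts b x y =
  [|| (x == b) && (y != b), low x && low y | high x && high y].
Proof.
rewrite /xi_inserts lt_min gt_max /low /high /before; case: dual => //.
by congr orb; rewrite orbC.
Qed.

Lemma xi_wordE c (s : seq A) :
  xi_word b (c :: s) = insert_b (xi_inserts b) (c :: s) c.
Proof.
have zipE u y : flatten [seq p.1 :: nseq (xi_inserts b p.1 p.2) b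
    | p <- zip u (rcons (behead u) y)] = insert_b (xi_inserts b) u y.
  by elim: u => // x [|z u] //= ->.
by rewrite -zipE /xi_word rot1_cons.
Qed.

(** [inserts] places the [b] added to a run in front of the run, [xi_inserts] at its end. A pending
    [b] is carried across the run letter by letter. *)
Lemma insert_b_shift c (s : seq A) y : path separated c (rcons s y) ->
  nseq (c == b) b ++ insert_b inserts (c :: s) y =
  insert_b (xi_inserts b) (c :: s) y ++ nseq (y == b) b.
Proof.
have letterE x z : separated x z ->
    nseq (x == b) b ++ x :: nseq (inserts x z) b =
    x :: nseq (xi_inserts b x z) b ++ nseq (z == b) b.
  rewrite /separated /inserts xi_insertsE.
  by case: (lowP x) => hx; case: (lowP z) => hz; rewrite ?hx ?hz.
elim: s c => [|x s IHs] c /=; first by rewrite andbT !cats0 => /letterE.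
move=> /andP[/letterE Ec /IHs IH].
rewrite -[c :: nseq _ _ ++ _]/((c :: nseq (inserts c x) b) ++ insert_b inserts (x :: s) y).
by rewrite catA Ec /= -catA IH -catA.
Qed.

(** With [y = c] in [insert_b_shift] the two insertions agree, except that for [c = b] they differ
    by moving one [b] from one end to the other. *)
Lemma xi_word_conjugate_insert c (s : seq A) : cycle separated (c :: s) ->
  conjugate (xi_word b (c :: s)) (insert_b inserts (c :: s) c).
Proof.
rewrite xi_wordE => /insert_b_shift; move: (insert_b inserts _ _) => Y; move: (insert_b _ _ _) => X.
case: (c == b) => [/= e|]; last by rewrite cats0 /= => ->; apply: conjugate_refl.
rewrite cats1 in e; have -> : Y = behead (rcons X b) by rewrite -e.
case: X e => [|x X] /= e; first exact: conjugate_refl.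
by have [<- _] := e; rewrite -rot1_cons; apply: conjugate_rot.
Qed.

(** [psi s] begins with [b] or with a high letter. *)
Lemma before_psi x s : low x -> before dual x (psi s 0).
Proof.
move=> lx; rewrite /psi; case hs: (high (s 0)) => //=.
exact: before_trans lx hs.
Qed.

Lemma high_slt s t : slt dual s t -> high (s 0) -> high (t 0).
Proof. by case=> [x y ? ? xy|//] /= hx; apply: before_trans hx xy. Qed.

(** * Cuts of the image under [xi b] *)

Section Cuts.
Variable w : seq A.
Hypotheses (w_neq0 : w <> [::]) (sep_w : cycle separated w).

Lemma cut_separated l r : cut w l r -> separated (l 0) (r 0).
Proof. by move: l r; apply/cycle_cutP. Qed.

Lemma cut_separatedr l x r : cut w l (scons x r) -> separated x (r 0).
Proof. by move=> /(cut_shiftr w_neq0)/cut_separated. Qed.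

(** The image of the cut leaves the [b] at the seam, if there is one, on the left side; in
    [cut_phi_psi] it is on the right side. *)
Lemma cut_psi_phi l r : cut w l r -> high (r 0) = false ->
  cut (xi_word b w) (psi l) (phi r).
Proof.
move=> cut_lr; have sep0 := cut_separated cut_lr.
case: cut_lr => x [cx el er]; have := conjugate_neq0 cx w_neq0.
case: x cx el er => // c s cx el er _.
have er0 : r 0 = c by rewrite er.
have sep_cs : cycle separated (c :: s).
  by case/existsP: cx => i /eqP->; rewrite rot_cycle.
rewrite er0 in sep0 *; move=> nhigh_c; exists (insert_b inserts (c :: s) c); split.
- apply: conjugate_trans (xi_word_conjugate b cx) _.
  exact: xi_word_conjugate_insert.
- have := @psi_sapp_rev (c :: s) c l; rewrite nhigh_c -el; apply=> //=.
  by rewrite sep0.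
- by have := phi_sapp (c :: s) r; rewrite -er er0.
Qed.

(* A cut of w followed by b and the next one yield the same cut of xi_word b w. *)
Lemma psi_phi_b l r : cut w l (scons b r) ->
  psi l = phi (scons b l) /\ phi (scons b r) = psi r.
Proof.
move=> cut_br; rewrite !phi_nlow ?low_b //.
have nhl := separated_br (cut_separated cut_br).
have nhr := separated_bl (cut_separatedr cut_br).
by rewrite !psi_nhigh.
Qed.

(** Apply [cut_psi_phi] one letter further left. If that letter is low, shift the image back across
    it; if it is [b], [psi_phi_b] identifies the two images. *)
Lemma cut_phi_psi l r : cut w l r -> high (l 0) = false ->
  cut (xi_word b w) (phi l) (psi r).
Proof.
have xi_neq0 : xi_word b w <> [::] by apply/eqP/xi_word_neq0/eqP.
rewrite (scons_eta l) /=; move: (l 0) (stail l) => y {}l.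
move=> /(cut_shiftl w_neq0) cut_y nhy.
have [ly|hy|ey] := lowP y; last 2 first.
- by rewrite /high hy in nhy.
- rewrite ey in cut_y *; have [<- <-] := psi_phi_b cut_y.
  exact: cut_psi_phi cut_y high_b.
have := cut_psi_phi cut_y nhy; rewrite !phi_low //.
exact: cut_shiftr.
Qed.

Definition image_cut l' r' : Prop := exists l r, cut w l r /\
  ([/\ high (r 0) = false, l' = psi l & r' = phi r] \/
   [/\ high (l 0) = false, l' = phi l & r' = psi r]).

(** The images include one cut and are closed under shifting by one letter, so [cut_orbit] reaches
    all cuts. *)
Lemma image_cutP l' r' : cut (xi_word b w) l' r' -> image_cut l' r'.
Proof.
have xi_neq0 : xi_word b w <> [::] by apply/eqP/xi_word_neq0/eqP.
(* If the letter after a cut is high, the one after it is low, and the next cut will do. *)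
have [l [r [cut_lr nhr]]] : exists l r, cut w l r /\ high (r 0) = false.
  have [l [r [_ _ cut_lr]]] := cut_exists w_neq0.
  case hr: (high (r 0)); last by exists l, r.
  move: cut_lr hr; rewrite (scons_eta r) /= => cut_lr hr.
  exists (scons (r 0) l), (stail r); split; first exact: cut_shiftr.
  exact: low_nhigh (separated_highl (cut_separatedr cut_lr) hr).
move: l' r'; apply: (cut_orbit xi_neq0) (cut_psi_phi cut_lr nhr) _; last first.
  by exists l, r; split=> //; left.
move=> {cut_lr nhr}l' a r' [l1 [r1 [cut_lr []]]] {l r}.
  move=> [nhr el er]; move: cut_lr er nhr; rewrite (scons_eta r1) /=.
  move: (r1 0) (stail r1) => x r cut_lr.
  have cut_lr' := cut_shiftr w_neq0 cut_lr.
  have [lx|hx|ex] := lowP x.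
  + rewrite phi_low // => er nhx; have [-> ->] := scons_inj er.
    exists (scons x l1), r; split=> //; right; split=> //; first exact: low_nhigh.
    by rewrite phi_low // el.
  + by [] .
  + rewrite ex phi_nlow ?low_b // => er _; have [-> ->] := scons_inj er.
    rewrite ex in cut_lr cut_lr'; have [e1 _] := psi_phi_b cut_lr.
    exists (scons b l1), r; split=> //; left.
    rewrite (separated_bl (cut_separatedr cut_lr)) psi_cons ?high_b //.
    by rewrite el e1.
move=> [nhl el er].
move: cut_lr er; rewrite (scons_eta r1) /=; move: (r1 0) (stail r1) => x r cut_lr.
case hx: (high x).
  rewrite psi_high // phi_nlow ?high_nlow // => er; have [-> ->] := scons_inj er.
  exists (scons x l1), r; split; first exact: cut_shiftr; left.
  rewrite psi_high // phi_nlow ?high_nlow // el; split=> //.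
  exact: low_nhigh (separated_highl (cut_separatedr cut_lr) hx).
(* Crossing the [b] added by [psi] stays at the same cut of [w], now in the first form of image. *)
rewrite psi_cons // => er; have [-> ->] := scons_inj er.
exists l1, (scons x r); split=> //; left; split=> //.
by rewrite psi_nhigh // el.
Qed.

(** For two image cuts of different forms, the inequalities compare two values of [phi] and two
    values of [psi], and both maps preserve and reflect [slt]. *)
Lemma order_condition_xi_word :
  order_condition dual w <-> order_condition dual (xi_word b w).
Proof.
split=> [ow l1 r1 l2 r2 /image_cutP[l [r [c t]]] /image_cutP[l' [r' [c' t']]]
        |ow l r l' r' c c' lt1 lt2].
  have mixed l3 r3 l4 r4 : cut w l3 r3 -> cut w l4 r4 ->
      slt dual (phi r3) (phi l4) -> ~ slt dual (psi l3) (psi r4).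
    move=> c3 c4 /(slt_reflect phi_slt) lt1 /(slt_reflect psi_slt) lt2.
    exact: ow c3 c4 lt1 lt2.
  have mixed' l3 r3 l4 r4 : cut w l3 r3 -> cut w l4 r4 ->
      slt dual (psi r3) (psi l4) -> ~ slt dual (phi l3) (phi r4).
    move=> c3 c4 /(slt_reflect psi_slt) lt1 /(slt_reflect phi_slt) lt2.
    exact: ow c3 c4 lt1 lt2.
  case: t => -[nh -> ->] {l1 r1}; case: t' => -[nh' -> ->] {l2 r2}.
  (* Two cuts of the same form: a low letter next to the second cut decides one comparison the wrong
     way, and a [b] there allows a move to the neighbouring cut, which has the other form. *)
  - move: c' nh'; rewrite (scons_eta r'); move: (r' 0) (stail r') => x {}r' c' /= nhx.
    have [lx|hx|ex] := lowP x; last 2 first.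
    + by rewrite /high hx in nhx.
    + rewrite ex in c' *; have [-> ->] := psi_phi_b c'.
      by apply: mixed => //; apply: cut_shiftr.
    + by move=> _ /slt_head; rewrite phi_head /= before_psi.
  - exact: mixed.
  - exact: mixed'.
  - move: c' nh'; rewrite (scons_eta l'); move: (l' 0) (stail l') => x {}l' c' /= nhx.
    have [lx|hx|ex] := lowP x; last 2 first.
    + by rewrite /high hx in nhx.
    + rewrite ex in c' *; have c2 := cut_shiftl w_neq0 c'.
      by have [<- <-] := psi_phi_b c2; apply: mixed'.
    + by move=> /slt_head; rewrite phi_head /= before_psi.
(* Whether [l' 0] is high decides which cut gets which form; the side conditions follow from [lt1],
   [lt2] and separation. *)
case hl': (high (l' 0)); last first.
  have hr : high (r 0) = false by apply/negP => /(high_slt lt1); rewrite hl'.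
  exact: ow (cut_psi_phi c hr) (cut_phi_psi c' hl') (phi_slt lt1) (psi_slt lt2).
have hr' : high (r' 0) = false.
  exact: low_nhigh (separated_highl (cut_separated c') hl').
have hl : high (l 0) = false by apply/negP => /(high_slt lt2); rewrite hr'.
exact: ow (cut_phi_psi c hl) (cut_psi_phi c' hr') (psi_slt lt1) (phi_slt lt2).
Qed.

End Cuts.

(** * Counting letters *)

(** Each low letter is followed by an inserted [b] or by a high letter, and each high letter follows
    a low one. The terms [high y] and [high c] correct for the two ends of the word. *)
Lemma count_insert_b c (s : seq A) y : path separated c (rcons s y) ->
  count_mem b (insert_b inserts (c :: s) y) + count high (c :: s) + high y =
  count_mem b (c :: s) + count low (c :: s) + high c.
Proof.
have letterE x z : separated x z -> inserts x z + high z = low x.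
  rewrite /separated /inserts.
  by case: (lowP x) => hx; case: (lowP z) => hz; rewrite ?hx ?hz.
elim: s c => [|x s IHs] c /=.
  by rewrite andbT => /letterE; rewrite cats0 count_nseq /= eqxx; lia.
by move=> /andP[/letterE Ec /IHs /= IH]; rewrite count_cat count_nseq /= eqxx; lia.
Qed.

Lemma count_insert_neq (i : rel A) u y d : d != b ->
  count_mem d (insert_b i u y) = count_mem d u.
Proof.
move=> neq_db; elim: u => //= x u IHu.
by rewrite count_cat count_nseq IHu /= [b == d]eq_sym (negPf neq_db) mul0n.
Qed.

Lemma count_xi_word w : cycle separated w ->
  count_mem b (xi_word b w) + count high w = count_mem b w + count low w.
Proof.
case: w => // c s sep_w; rewrite -(conjugate_count _ (xi_word_conjugate_insert sep_w)).
exact: addIn (count_insert_b sep_w).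
Qed.

Lemma count_xi_word_neq w d : d != b -> count_mem d (xi_word b w) = count_mem d w.
Proof. by case: w => // c s; rewrite xi_wordE; apply: count_insert_neq. Qed.

Lemma count_low_high w : count low w + count high w + count_mem b w = size w.
Proof. by elim: w => //= x w; case: (lowP x); lia. Qed.

Lemma path_count (p q : pred A) c (s : seq A) :
  path (fun x y => p x ==> q y) c s -> count p (belast c s) <= count q s.
Proof.
elim: s c => //= x s IHs c /andP[/implyP pq /IHs le_pq].
by apply: leq_add => //; case: (p c) pq => // ->.
Qed.

(** Passing to the cyclic successor injects the occurrences of [p] into those of [q]. *)
Lemma cycle_count (p q : pred A) w :
  cycle (fun x y => p x ==> q y) w -> count p w <= count q w.
Proof.
case: w => // c s /= /path_count.
by rewrite belast_rcons -cats1 count_cat /=; lia.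
Qed.

(** * Adjacent letters under the order condition *)

Lemma order_condition_separated w : order_condition dual w ->
  count high w < count low w -> cycle separated w.
Proof.
move=> ow lt_hl; have w_neq0 : w <> [::] by move=> e; rewrite e in lt_hl.
apply/(cycle_cutP _ w_neq0) => l r c.
have nhighP x : high x = false -> before dual x b \/ x = b.
  by case: (lowP x); auto.
have nlowP x : low x = false -> before dual b x \/ x = b.
  by case: (lowP x); auto.
apply/andP; split; apply/implyP => hx; apply/negPn/negP => /negPf lx;
  move: lt_hl; rewrite ltnNge => /negP; apply.
  (* A high letter followed by a non-low one forces every low letter to be followed by a high
     one. *)
  apply: cycle_count; apply/(cycle_cutP _ w_neq0) => l' r' c'.
  apply/implyP => lx'; apply/negPn/negP => /negPf hx'.
  have := order_condition_head ow c' c.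
  have -> : before dual (r' 0) (l 0).
    by case: (nhighP _ hx') => [lt_b|->] //; apply: before_trans lt_b hx.
  move=> /(_ isT); case: (nlowP _ lx) => [gt_b|->]; last by rewrite [before _ _ _]lx'.
  by rewrite (before_trans lx' gt_b).
(* A high letter preceded by a non-low one forces every low letter to be preceded by a high one;
   this is counted through complements. *)
suff : count (predC high) w <= count (predC low) w.
  by rewrite -(leq_add2l (count high w)) count_predC -(count_predC low) leq_add2r.
apply: cycle_count; apply/(cycle_cutP _ w_neq0) => l' r' c' /=.
apply/implyP => /negPf hx'; apply/negP => lx'.
have := order_condition_head ow c' c.
have -> : before dual (r' 0) (l 0).
  by case: (nlowP _ lx) => [gt_b|->] //; apply: before_trans lx' gt_b.
move=> /(_ isT); case: (nhighP _ hx') => [lt_b|->]; last by rewrite [before _ _ _]hx.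
by rewrite (before_trans lt_b hx).
Qed.

(** Two adjacent low letters exclude two adjacent non-low ones, which by separation would both be
    [b]. So every non-low letter is followed by a low one, and there would be too many low
    letters. *)
Lemma order_condition_no_low_low w : order_condition dual w -> cycle separated w ->
    0 < count low w <= count high w + count_mem b w ->
  cycle (fun x y => ~~ (low x && low y)) w.
Proof.
move=> ow sep_w /andP[lt0 le_lhb]; have w_neq0 : w <> [::] by move=> e; rewrite e in lt0.
apply/(cycle_cutP _ w_neq0) => l r c; apply/negP => /andP[ll lr].
have cyc : cycle (fun x y => ~~ low x ==> low y) w.
  apply/(cycle_cutP _ w_neq0) => l' r' c'; apply/implyP => /negPf nl.
  have sep := cut_separated w_neq0 sep_w c'; apply/negPn/negP => /negPf nr.
  have := order_condition_head ow c c'; move: sep nl nr; rewrite /separated.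
  case: (lowP (l' 0)) => // hl; case: (lowP (r' 0)) => // hr _ _ _.
  by rewrite hl hr [before _ (r 0) _]lr [before _ _ _]ll => /(_ isT).
(* With the low pair at the seam, [d] is a low letter that follows no non-low one, which makes the
   count strict. *)
have [d [s [cds e_r e_l]]] := cut_ends w_neq0 c.
have : cycle (fun x y => ~~ low x ==> low y) (d :: s).
  by case/existsP: cds => i /eqP->; rewrite rot_cycle.
rewrite /= rcons_path => /andP[p_s _].
have le_s : count (predC low) (belast d s) <= count low s by apply: path_count.
have e_nlow : count (predC low) (d :: s) = count (predC low) (belast d s).
  by rewrite lastI -cats1 count_cat /= -e_l ll /= !addn0.
have e_low : count low (d :: s) = (count low s).+1 by rewrite /= -e_r lr.
rewrite (conjugate_count _ cds) in e_nlow; rewrite (conjugate_count _ cds) in e_low.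
by have := count_predC low w; have := count_low_high w; lia.
Qed.

(** * Preimages under [xi b] *)

Definition spaced : rel A := [rel x y | separated x y && ~~ (low x && low y)].

(* y is the letter preceding u. *)
Fixpoint delete_b y u : seq A :=
  if u is x :: u' then
    if low y && (x == b) then delete_b x u' else x :: delete_b x u'
  else [::].

(** In a spaced word a low letter is followed by a high letter or by [b]. Only the first [b] of a
    run is deleted, and the letter after it is not high, so [inserts] restores it. *)
Lemma delete_bK c y (s : seq A) : low c ->
    path spaced y (rcons s c) ->
  insert_b inserts (y :: delete_b y s) c = y :: s.
Proof.
move=> lc; elim: s y => [|x s IHs] y /=.
  by rewrite /spaced /= lc !andbT /inserts => /andP[_ /negPf->].
move=> /andP[/andP[sep_yx nll] p_s]; have := IHs _ p_s; rewrite /=.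
have [ex|neq_xb] := eqVneq x b; last first.
  rewrite andbF /= => ->; rewrite /inserts; case ly: (low y) nll => //=.
  by move: neq_xb; rewrite /low /high; case: beforeP.
rewrite ex in sep_yx p_s *; rewrite andbT.
case: (boolP (low y)) => ly /=; last by rewrite /inserts (negPf ly) => /= ->.
rewrite {1}/inserts low_b /= => -[->]; rewrite /inserts ly.
case: s p_s {IHs} => [|z s] /=; first by rewrite (low_nhigh lc).
by rewrite low_b /= => /andP[/andP[/separated_bl->]].
Qed.

(** A deletion brings a low letter next to the letter that followed [b], which is not high. *)
Lemma delete_b_separated c y (s : seq A) :
    path spaced y (rcons s c) ->
  path separated y (rcons (delete_b y s) c).
Proof.
elim: s y => [|x s IHs] y /=; first by rewrite !andbT => /andP[].
move=> /andP[/andP[sep_yx _] /IHs].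
case: (boolP (low y && (x == b))) => [/andP[ly /eqP ex]|_] /=; last by rewrite sep_yx.
rewrite ex; case: (delete_b b s) => [|z t] /= /andP[/separated_bl hz p_t];
  by rewrite /separated hz (low_nhigh ly) ?p_t.
Qed.

Lemma xi_word_preimage w : order_condition dual w ->
    count high w < count low w <= count high w + count_mem b w ->
  exists w', [/\ w' <> [::], cycle separated w' & conjugate w (xi_word b w')].
Proof.
move=> ow /andP[lt_hl le_l]; have sep_w := order_condition_separated ow lt_hl.
have nll_w : cycle (fun x y => ~~ (low x && low y)) w.
  by apply: order_condition_no_low_low => //; rewrite le_l (leq_ltn_trans _ lt_hl).
(* Starting at a low letter, which is never deleted, makes linear deletion agree with cyclic
   deletion. *)
have /hasP[c c_w lc] : has low w by rewrite has_count (leq_ltn_trans _ lt_hl).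
have [s cs] : exists s : seq A, conjugate w (c :: s).
  case/splitPr: c_w => s1 s2; exists (s2 ++ s1); apply/conjugateP.
  by exists s1, (c :: s2).
have p_s : path spaced c (rcons s c).
  suff : cycle spaced (c :: s) by [].
  rewrite cycle_relI.
  by case/existsP: cs => i /eqP->; rewrite !rot_cycle sep_w.
have sep' : cycle separated (c :: delete_b c s) by apply: delete_b_separated.
exists (c :: delete_b c s); split=> //.
apply: conjugate_trans cs _; rewrite -(delete_bK lc p_s).
exact/conjugate_sym_imp/xi_word_conjugate_insert.
Qed.

End Substitution.

(** * One step of the algorithm and its final power *)

Section Main.
Context {disp : Order.disp_t} {A : finOrderType disp}.
Implicit Types (b d : A) (w : seq A) (n : {ffun A -> nat}).

Lemma sum_count (p : pred A) w : \sum_(a | p a) count_mem a w = count p w.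
Proof.
elim: w => [|x w IHw] /=; first by rewrite big1.
rewrite big_split /= IHw; congr (_ + _).
case px: (p x).
  rewrite (bigD1 x) //= eqxx big1 ?addn0 // => a /andP[_].
  by rewrite eq_sym => /negPf->.
by rewrite big1 // => a pa; case: eqP => // exa; rewrite exa pa in px.
Qed.

Lemma sum_off_count n b (p : pred A) w : (forall d, p d -> d != b) ->
    (forall d, d != b -> count_mem d w = n d) ->
  (\sum_(a | p a) (n a)%:Z = (count p w)%:Z)%R.
Proof.
move=> pb nw; rewrite -sum_count (big_morph Posz PoszD erefl).
by apply: eq_bigr => a /pb/nw->.
Qed.

(** The order is reversed exactly when [delta n b] is positive. Only letters other than [b] enter,
    so this serves for the Parikh vectors [n] and [xi_reduce n b] alike. *)
Lemma delta_low_high n b : exists dual, forall w,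
    (forall d, d != b -> count_mem d w = n d) ->
  count (low dual b) w = count (high dual b) w + `|delta n b|%N.
Proof.
exists (0 < delta n b)%R => w nw.
have e_delta : (delta n b = (count (low true b) w)%:Z - (count (low false b) w)%:Z)%R.
  rewrite /delta !(@sum_off_count n b _ w) // => d; first by move/lt_eqF => ->.
  by move/gt_eqF => ->.
have highE : (count (high true b) w = count (low false b) w) *
  (count (high false b) w = count (low true b) w) by [].
by case: ltP; rewrite !highE; lia.
Qed.

Lemma xi_reduce_neq n b d : d != b -> xi_reduce n b d = n d.
Proof. by move=> /negPf neq; rewrite !ffunE neq subn0. Qed.

Lemma xi_reduce_eq n b : xi_reduce n b b = n b - `|delta n b|%N.
Proof. by rewrite !ffunE eqxx. Qed.

Lemma parikhP w (w0 : w != [::]) n :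
  parikh (cyclic_of w0) = n <-> forall d, count_mem d w = n d.
Proof.
rewrite parikh_cyclic_of; split=> [<- d|nw]; first by rewrite ffunE.
by apply/ffunP => d; rewrite ffunE.
Qed.

Lemma unique_xi_step n b (omega : cyclic_word A) :
    `|delta n b|%N <= n b -> delta n b <> 0%R ->
    unique (fun o : cyclic_word A => singular o /\ parikh o = xi_reduce n b) omega ->
  unique (fun o : cyclic_word A => singular o /\ parikh o = n) (xi b omega).
Proof.
move=> le_delta /eqP; rewrite -absz_gt0 => delta_gt0 [[sing par] uniq_omega].
have [dual low_high] := delta_low_high n b.
split=> [|omega2 [sing2 par2]].
  rewrite -(linearizeK omega) in sing par *.
  move: (linearize omega) (linearize_neq0 omega) sing par => w w0 /singularP.
  move=> /(order_condition_dual dual) ow /parikhP cw.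
  have {}low_high : count (low dual b) w = count (high dual b) w + `|delta n b|%N.
    by apply: low_high => d neq; rewrite cw xi_reduce_neq.
  have sep_w : cycle (separated dual b) w.
    by apply: order_condition_separated ow _; rewrite low_high -[ltnLHS]addn0 ltn_add2l.
  have w_neq0 := elimN eqP w0.
  rewrite xi_cyclic_of; split.
    by apply/singularP/(order_condition_dual dual)/(order_condition_xi_word w_neq0 sep_w).
  apply/parikhP => d; have [->|neq] := eqVneq d b; last first.
    by rewrite count_xi_word_neq // cw xi_reduce_neq.
  (* [xi b] adds back what [xi_reduce] removed; [le_delta] makes that subtraction exact. *)
  have := count_xi_word sep_w; rewrite cw xi_reduce_eq low_high.
  rewrite [count (high _ _) w + _]addnC addnA subnK //.
  exact: addIn.
rewrite -(linearizeK omega2) in sing2 par2 *.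
move: (linearize omega2) (linearize_neq0 omega2) sing2 par2 => w w0 /singularP.
move=> /(order_condition_dual dual) ow /parikhP cw.
have [|w' [w'_neq0 sep_w' conj_w]] := @xi_word_preimage _ _ dual b w ow.
  (* The strict bound is [delta_gt0], the upper one [le_delta]. *)
  by rewrite low_high // -[ltnLHS]addn0 ltn_add2l delta_gt0 leq_add2l cw.
have w'0 : w' != [::] by apply/eqP.
have cw' d : d != b -> count_mem d w' = n d.
  by move=> neq; rewrite -(count_xi_word_neq w' neq) (conjugate_count _ conj_w).
have -> : omega = cyclic_of w'0.
  apply: uniq_omega; split.
    apply/singularP/(order_condition_dual dual)/(order_condition_xi_word w'_neq0 sep_w').
    exact: order_condition_conjugate conj_w ow.
  apply/parikhP => d; have [->|neq] := eqVneq d b; last by rewrite xi_reduce_neq // cw'.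
  rewrite xi_reduce_eq; have := count_xi_word sep_w'.
  rewrite (conjugate_count _ conj_w) cw low_high //; lia.
by rewrite xi_cyclic_of; apply/cyclic_of_eq/conjugate_sym_imp.
Qed.

Lemma unique_power b k :
  unique (fun o : cyclic_word A => singular o /\ parikh o = scaled_unit k.+1 b)
    (power b k).
Proof.
split=> [|omega [_]].
  split; last first.
    by apply/parikhP => d; rewrite count_nseq ffunE eq_sym /=; case: eqP; rewrite ?mul1n.
  (* Every factor of a power of [b] is a palindrome, so singularity holds vacuously. *)
  move=> u v _ _ [uv0 /cyclic_of_eq/conjugate_sym_imp conj_uv] nu; case: nu.
  have all_b : all (pred1 b) (u ++ v).
    case/existsP: conj_uv => i /eqP->.
    by apply/allP => x; rewrite mem_rot => /nseqP[->] /=.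
  move: all_b; rewrite all_cat => /andP[/all_pred1P-> _].
  by rewrite rev_nseq.
rewrite -(linearizeK omega).
move: (linearize omega) (linearize_neq0 omega) => w w0 /parikhP cw.
have ew : w = nseq (size w) b.
  apply/all_pred1P/allP => x x_w /=; apply/negPn/negP => neq.
  by have := cw x; rewrite ffunE (negPf neq); apply/eqP; rewrite -lt0n -has_count has_pred1.
have sw : size w = k.+1.
  by have := cw b; rewrite ffunE eqxx ew count_nseq /= eqxx mul1n size_nseq.
by apply/cyclic_of_eq; rewrite ew sw conjugate_refl.
Qed.

End Main.

Theorem theorem4p13 (disp : Order.disp_t) (A : finOrderType disp)
    (v : {ffun A -> nat}) (omega : cyclic_word A) :
  v <> [ffun=> 0] ->
  xi_algorithm v omega ->
  unique (fun omega' : cyclic_word A => singular omega' /\ parikh omega' = v)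
    omega.
Proof.
move=> _; elim=> {v omega} [n b k _ _ ->|n b omega [le_delta _] delta_neq0 _].
  exact: unique_power.
exact: unique_xi_step.
Qed.
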